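(* Let $m$ be a universal lower semicomputable discrete semimeasure. If $e$ is an upper semicomputable sumtest for $m$, then there is a constant $c$ (depending on $e$) such that for all strings $x$ of length at least $2$, \[ e(x)\le c\,|x|\,(\log|x|)^2 . \]
   Context: A discrete semimeasure is a function $P$ from finite binary strings to non-negative reals with $\sum_x P(x)\le1$; it is lower semicomputable if it is the limit of a computable nondecreasing sequence of rational-valued approximations. $m$ is universal if it is a lower semicomputable semimeasure such that for each lower semicomputable semimeasure $P$ there is $c>0$ with $P\le c\,m$. A sumtest for $m$ is a function $f$ from strings to non-negative reals with $\sum_x m(x)f(x)\le 1$; upper semicomputable means it is the limit of a computable nonincreasing sequence of rational approximations. $|x|$ is the length of $x$; logarithms are base 2. *)

(* Defs.v *)
From mathcomp Require Import all_boot all_order all_algebra.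
From mathcomp Require Import all_classical all_reals all_analysis.

Set Implicit Arguments.
Unset Strict Implicit.
Unset Printing Implicit Defensive.

Import Order.TTheory GRing.Theory Num.Theory.
Import numFieldNormedType.Exports.

Local Open Scope classical_set_scope.
Local Open Scope ring_scope.

(* The total (general) recursive functions: the least class of functions
   nat^k -> nat containing the initial functions and closed under composition,
   primitive recursion and minimization of regular functions.  In rec_min the
   function h is the minimization of f: h v is the least n such that
   f (n, v) = 0; that every v admits such an n is part of the hypotheses. *)
Inductive recursive : forall k : nat, (k.-tuple nat -> nat) -> Prop :=
| rec_zero (k : nat) : @recursive k (fun=> 0%N)
| rec_succ : @recursive 1 (fun v => (thead v).+1)
| rec_proj (k : nat) (i : 'I_k) : @recursive k (fun v => tnth v i)
| rec_comp (k n : nat) (f : n.-tuple nat -> nat)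
    (g : 'I_n -> k.-tuple nat -> nat) :
    recursive f -> (forall i, recursive (g i)) ->
    @recursive k (fun v => f [tuple g i v | i < n])
| rec_prim (k : nat) (f : k.-tuple nat -> nat) (g : k.+2.-tuple nat -> nat) :
    recursive f -> recursive g ->
    @recursive k.+1 (fun v =>
      iteri (thead v) (fun n r => g [tuple of n :: r :: behead_tuple v])
            (f (behead_tuple v)))
| rec_min (k : nat) (f : k.+1.-tuple nat -> nat) (h : k.-tuple nat -> nat) :
    recursive f ->
    (forall v, f [tuple of h v :: v] = 0%N) ->
    (forall v n, (n < h v)%N -> f [tuple of n :: v] <> 0%N) ->
    @recursive k h.

(* The string x is coded by the number whose binary expansion is 1x. *)
Definition string_code (x : seq bool) : nat :=
  foldl (fun (n : nat) (b : bool) => (n.*2 + b)%N) 1%N x.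

Lemma string_code_inj : injective string_code.
Proof.
move=> x y; rewrite /string_code.
have pos z : (0 < foldl (fun (n : nat) (b : bool) => (n.*2 + b)%N) 1%N z)%N.
  elim/last_ind: z => // z b IH.
  by rewrite foldl_rcons ltn_addr // double_gt0.
elim/last_ind: x y => [|x a IH] y; elim/last_ind: y => [|y b _] //.
- rewrite foldl_rcons; move: (pos y); set n := foldl _ _ y.
  by case: n => // n _; case: b; rewrite /= doubleS !addSn.
- rewrite foldl_rcons; move: (pos x); set n := foldl _ _ x.
  by case: n => // n _; case: a; rewrite /= doubleS !addSn.
- rewrite !foldl_rcons => E.
  have ab : a = b by have := congr1 odd E; rewrite !oddD !odd_double !oddb.
  by move: E; rewrite ab => /addIn /double_inj /IH ->.
Qed.

(* Sign, numerator and denominator are recursive in the stage and the string,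
   jointly; the fraction need not be in lowest terms. *)
Definition computable_rat_approx (q : nat -> seq bool -> rat) : Prop :=
  exists s a b : 2.-tuple nat -> nat,
    [/\ recursive s, recursive a, recursive b &
        forall (t : nat) (x : seq bool),
          let v := [tuple t; string_code x] in
          (0 < b v)%N /\ q t x = (-1) ^+ s v * (a v)%:R / (b v)%:R].

Definition lower_semicomputable (R : realType) (f : seq bool -> R) : Prop :=
  exists q : nat -> seq bool -> rat,
    [/\ computable_rat_approx q,
        forall x, nondecreasing_seq (q ^~ x) &
        forall x, (fun t => ratr (q t x) : R) @ \oo --> f x].

Definition upper_semicomputable (R : realType) (f : seq bool -> R) : Prop :=
  exists q : nat -> seq bool -> rat,
    [/\ computable_rat_approx q,
        forall x, nonincreasing_seq (q ^~ x) &
        forall x, (fun t => ratr (q t x) : R) @ \oo --> f x].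

Definition discrete_semimeasure (R : realType) (P : seq bool -> R) : Prop :=
  (forall x, 0 <= P x) /\
  (\esum_(x in [set: seq bool]) (P x)%:E <= 1)%E.

Definition universal_semimeasure (R : realType) (m : seq bool -> R) : Prop :=
  [/\ discrete_semimeasure m, lower_semicomputable m &
      forall P : seq bool -> R,
        discrete_semimeasure P -> lower_semicomputable P ->
        exists2 c : R, 0 < c & forall x, P x <= c * m x].

Definition sumtest (R : realType) (m f : seq bool -> R) : Prop :=
  (forall x, 0 <= f x) /\
  (\esum_(x in [set: seq bool]) (m x * f x)%:E <= 1)%E.

Definition log2 (R : realType) (y : R) : R := ln y / ln 2.

(* Main.v *)
(* Split the strings into levels, level k holding those of lengths in
   [2^k, 2^(k+1)), and put D k = 8 * 2^k * (k+1) * (k+2).  For a threshold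
   4^j * D k let S_s be the set of strings x of level k whose s-th upper
   approximation of e x is at least the threshold; S_s decreases in s.  For
   every i < 2^(k+1), as soon as S_s has fewer than 2^(i+1) elements each of
   them receives mass
   2^-i * 2^-j / D k.  At most 4 * 2^(k+1) / D k is spent on level k in total,
   and these amounts sum to at most 1, so the rewards define a lower
   semicomputable semimeasure P <= c * m.  If e x reaches the threshold for some
   x of level k, the strings that stay in S_s forever have total P-mass at least
   2^-j / D k, so c >= sum P e >= 2^j.  Taking 2^j > c bounds e by 4^j * D k,
   which is O(n log^2 n) at length n.  Treating a dyadic block of lengths at
   once, rather than each length, is what saves a factor n. *)
Require Import Defs.
From mathcomp Require Import all_boot all_order all_algebra.
From mathcomp Require Import all_classical all_reals all_analysis.
From mathcomp Require Import ring zify.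
Import Order.TTheory GRing.Theory Num.Theory.
Import numFieldNormedType.Exports.
Local Open Scope ring_scope.

(** * Closure properties of the recursive functions *)

Section Recursive.
Local Open Scope nat_scope.

Lemma trunc_log_le p n : (trunc_log p n <= n)%N.
Proof.
have [p_le1|p_gt1] := leqP p 1.
  by have /eqP -> : trunc_log p n == 0%N by rewrite trunc_log_eq0 p_le1.
have [->|n_gt0] := posnP n; first by rewrite trunc_log0.
by apply: ltnW; apply: leq_trans (ltn_expl _ p_gt1) (trunc_logP p_gt1 n_gt0).
Qed.

Lemma recursive_ext {k} (f g : k.-tuple nat -> nat) :
  f =1 g -> recursive f -> recursive g.
Proof. by move=> /funext ->. Qed.

Lemma recursive_comp {k n} (f : n.-tuple nat -> nat)
    (h : k.-tuple nat -> n.-tuple nat) :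
  recursive f -> (forall i, recursive (fun v => tnth (h v) i)) ->
  recursive (fun v => f (h v)).
Proof.
move=> rf rh; apply: recursive_ext (rec_comp rf rh) => v.
by congr f; apply: eq_from_tnth => i; rewrite tnth_mktuple.
Qed.

Lemma recursive_comp1 {k} (f : 1.-tuple nat -> nat) (g : k.-tuple nat -> nat) :
  recursive f -> recursive g -> recursive (fun v => f [tuple g v]).
Proof.
by move=> rf rg; apply: recursive_comp rf _ => i; rewrite (ord1 i).
Qed.

Lemma recursive_cons {k n} (f : n.+1.-tuple nat -> nat)
    (g : k.-tuple nat -> nat) (h : k.-tuple nat -> n.-tuple nat) :
  recursive f -> recursive g -> (forall i, recursive (fun v => tnth (h v) i)) ->
  recursive (fun v => f [tuple of g v :: h v]).
Proof.
move=> rf rg rh; apply: recursive_comp rf _ => i.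
case: (unliftP ord0 i) => [j ->|->].
  by apply: recursive_ext (rh j) => v; rewrite tnthS.
by apply: recursive_ext rg => v; rewrite tnth0.
Qed.

Lemma recursive_comp2 {k} (f : 2.-tuple nat -> nat)
    (g h : k.-tuple nat -> nat) :
  recursive f -> recursive g -> recursive h ->
  recursive (fun v => f [tuple g v; h v]).
Proof.
move=> rf rg rh.
apply: (recursive_cons _ _ (fun v => [tuple h v]) rf rg) => i.
by rewrite (ord1 i).
Qed.

Lemma recursive_behead {k} (f : k.-tuple nat -> nat) :
  recursive f -> recursive (fun v : k.+1.-tuple nat => f (behead_tuple v)).
Proof.
move=> rf; apply: recursive_comp rf _ => i.
apply: recursive_ext (rec_proj (lift ord0 i)) => v.
by rewrite tnth_behead; congr tnth; apply: val_inj; rewrite /= inordK // ltnS.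
Qed.

Lemma recursive_thead k : recursive (fun v : k.+1.-tuple nat => thead v).
Proof. exact: rec_proj. Qed.

Lemma recursive_const {k} n : recursive (fun _ : k.-tuple nat => n).
Proof.
elim: n => [|n IHn]; first exact: rec_zero.
exact: (recursive_comp1 _ _ rec_succ IHn).
Qed.

Lemma recursive_succ {k} (f : k.-tuple nat -> nat) :
  recursive f -> recursive (fun v => (f v).+1).
Proof. exact: (recursive_comp1 _ _ rec_succ). Qed.

(** Primitive recursion in usable form: the counter and the accumulator are put in front of the
    parameters [v], and the recursion depth is itself a recursive function of [v]. *)
Lemma recursive_iteri {k} (G : nat -> nat -> k.-tuple nat -> nat)
    (N f : k.-tuple nat -> nat) :
  recursive N -> recursive f ->
  recursive (fun w : k.+2.-tuple nat =>
    G (thead w) (thead (behead_tuple w)) (behead_tuple (behead_tuple w))) ->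
  recursive (fun v => iteri (N v) (fun n r => G n r v) (f v)).
Proof.
move=> rN rf rG.
have := recursive_cons _ _ id (rec_prim rf rG) rN (@rec_proj k).
apply: recursive_ext => v.
have bE n (w : k.-tuple nat) : behead_tuple [tuple of n :: w] = w
  by apply: val_inj.
rewrite theadE bE; apply: eq_iteri => n r; rewrite theadE.
have -> : behead_tuple [tuple of n :: r :: v] = [tuple of r :: v]
  by apply: val_inj.
by rewrite theadE bE.
Qed.

Lemma recursive_add {k} (f g : k.-tuple nat -> nat) :
  recursive f -> recursive g -> recursive (fun v => f v + g v).
Proof.
move=> rf rg.
have := recursive_iteri (fun _ r _ => r.+1) _ _ rf rg.
move/(_ (recursive_succ _ (recursive_behead _ (recursive_thead _)))).
by apply: recursive_ext => v; elim: (f v) => //= n ->.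
Qed.

(** Going under a bounded sum makes the index the head of the tuple and moves the old arguments to
    its tail, hence the uses of [recursive_behead] in later proofs. *)
Lemma recursive_sum {k} (F : nat -> k.-tuple nat -> nat)
    (N : k.-tuple nat -> nat) :
  recursive N ->
  recursive (fun w : k.+1.-tuple nat => F (thead w) (behead_tuple w)) ->
  recursive (fun v => \sum_(i < N v) F i v).
Proof.
move=> rN rF.
have rG : recursive (fun w : k.+2.-tuple nat => thead (behead_tuple w) +
    F (thead w) (behead_tuple (behead_tuple w))).
  apply: recursive_add; first exact/recursive_behead/recursive_thead.
  have rbb i := recursive_behead _ (recursive_behead _ (@rec_proj k i)).
  have := recursive_cons (n := k) _ _ (fun w : k.+2.-tuple nat =>
    behead_tuple (behead_tuple w))
    rF (recursive_thead _) rbb.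
  by apply: recursive_ext => w; rewrite theadE; congr F; apply: val_inj.
have := recursive_iteri (fun i r v => r + F i v) _ _ rN (recursive_const 0) rG.
apply: recursive_ext => v.
by elim: (N v) => [|n IHn] /=; rewrite ?big_ord0 // big_ord_recr /= IHn.
Qed.

Lemma recursive_mul {k} (f g : k.-tuple nat -> nat) :
  recursive f -> recursive g -> recursive (fun v => f v * g v).
Proof.
move=> rf rg.
apply: recursive_ext
  (recursive_sum (fun=> g) _ rf (recursive_behead _ rg)) => v.
by rewrite sum_nat_const card_ord.
Qed.

Lemma recursive_exp {k} (f g : k.-tuple nat -> nat) :
  recursive f -> recursive g -> recursive (fun v => f v ^ g v).
Proof.
move=> rf rg.
have := recursive_iteri (fun _ r v => f v * r) _ _ rg (recursive_const 1).
move/(_ (recursive_mul _ _ (recursive_behead _ (recursive_behead _ rf))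
  (recursive_behead _ (recursive_thead _)))).
by apply: recursive_ext => v; elim: (g v) => //= n ->; rewrite expnS.
Qed.

Lemma recursive_pred {k} (f : k.-tuple nat -> nat) :
  recursive f -> recursive (fun v => (f v).-1).
Proof.
move=> rf.
have := recursive_iteri (fun n _ _ => n) _ _ rf (recursive_const 0)
  (recursive_thead _).
by apply: recursive_ext => v; case: (f v).
Qed.

Lemma recursive_sub {k} (f g : k.-tuple nat -> nat) :
  recursive f -> recursive g -> recursive (fun v => f v - g v).
Proof.
move=> rf rg.
have := recursive_iteri (fun _ r _ => r.-1) _ _ rg rf.
move/(_ (recursive_pred _ (recursive_behead _ (recursive_thead _)))).
by apply: recursive_ext => v; elim: (g v) => [|n IHn] /=;
  rewrite ?subn0 // subnS IHn.
Qed.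

Lemma recursive_leq {k} (f g : k.-tuple nat -> nat) :
  recursive f -> recursive g -> recursive (fun v => (f v <= g v) : nat).
Proof.
move=> rf rg.
(* Subtraction is truncated, so [1 - (f v - g v)] is 1 exactly when [f v <= g v]. *)
apply: recursive_ext
  (recursive_sub _ _ (recursive_const 1) (recursive_sub _ _ rf rg)) => v.
by rewrite -subn_eq0; case: (f v - g v).
Qed.

Lemma recursive_and {k} (f g : k.-tuple nat -> bool) :
  recursive (fun v => f v : nat) -> recursive (fun v => g v : nat) ->
  recursive (fun v => (f v && g v) : nat).
Proof.
move=> rf rg; apply: recursive_ext (recursive_mul _ _ rf rg) => v.
by rewrite mulnb.
Qed.

Lemma recursive_eq {k} (f g : k.-tuple nat -> nat) :
  recursive f -> recursive g -> recursive (fun v => (f v == g v) : nat).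
Proof.
move=> rf rg; apply: recursive_ext
  (recursive_and _ _ (recursive_leq _ _ rf rg) (recursive_leq _ _ rg rf)) => v.
by rewrite eqn_leq.
Qed.

Lemma recursive_exists {k} (F : nat -> k.-tuple nat -> bool)
    (N : k.-tuple nat -> nat) :
  recursive N ->
  recursive (fun w : k.+1.-tuple nat => F (thead w) (behead_tuple w) : nat) ->
  recursive (fun v => [exists i : 'I_(N v), F i v] : nat).
Proof.
move=> rN rF; apply: recursive_ext (recursive_leq _ _ (recursive_const 1)
  (recursive_sum (fun i v => F i v : nat) _ rN rF)) => v.
congr nat_of_bool; rewrite lt0n sum_nat_eq0 negb_forall.
by apply: eq_existsb => i; rewrite eqb0 negbK.
Qed.

(** The logarithm of n is the number of i < n with 2^(i+1) <= n, which is a bounded sum. *)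
Lemma recursive_trunc_log {k} (f : k.-tuple nat -> nat) :
  recursive f -> recursive (fun v => trunc_log 2 (f v)).
Proof.
move=> rf.
have rF : recursive (fun w : k.+1.-tuple nat =>
    (2 ^ (thead w).+1 <= f (behead_tuple w)) : nat).
  apply: recursive_leq (recursive_behead _ rf); apply: recursive_exp.
    exact: recursive_const.
  exact/recursive_succ/recursive_thead.
apply: recursive_ext (recursive_sum (fun i v => (2 ^ i.+1 <= f v) : nat)
  _ rf rF) => v.
have [->|f_gt0] := posnP (f v); first by rewrite big_ord0 trunc_log0.
transitivity (\sum_(i < f v) (i < trunc_log 2 (f v))).
  apply: eq_bigr => i _; congr nat_of_bool; apply/idP/idP => [|lt_i].
    exact: trunc_log_max.
  by apply: leq_trans (trunc_logP (p := 2) isT f_gt0); rewrite leq_exp2l.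
transitivity (\sum_(i < f v | i < trunc_log 2 (f v)) 1).
  by rewrite [RHS]big_mkcond; apply: eq_bigr => i _; case: ltnP.
by rewrite -(big_ord_widen _ (fun=> 1) (trunc_log_le 2 (f v)))
  sum1_card card_ord.
Qed.

End Recursive.

(** * Rewards and the total mass they distribute *)

(* The codes of the strings x with 2 ^ k <= size x < 2 ^ k.+1 have level k, and
   so has the empty string for k = 0; there are fewer than 2 ^ 2 ^ k.+1 of them. *)
Definition level (c : nat) : nat := trunc_log 2 (trunc_log 2 c).

Definition level_cost (k : nat) : nat := (8 * 2 ^ k * (k.+1 * k.+2))%N.

Section Mass.
(* S j s c: the code c is still alive at stage s for the threshold number j. *)
Variable S : nat -> nat -> nat -> bool.

Definition alive_count (j s k : nat) : nat :=
  (\sum_(c < 2 ^ 2 ^ k.+1) ((level c == k) && S j s c))%N.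

(* For each j, the codes of one level that are alive when fewer than 2 ^ i.+1
   codes of that level are left are rewarded 2 ^ - (i + j) / level_cost. *)
Definition rewarded (i j t c : nat) : bool :=
  [exists s : 'I_t.+1, S j s c && (alive_count j s (level c) < 2 ^ i.+1)%N].

(** Rewards are written over a common denominator to stay within natural numbers. One mass serves
    all threshold numbers [j], because the constant given by universality has to be known before [j]
    is chosen; stage [t] includes those up to [t]. *)
Definition mass_num (t c : nat) : nat :=
  (\sum_(i < 2 ^ (level c).+1) \sum_(j < t.+1)
     2 ^ (2 ^ (level c).+1 - i) * 2 ^ (t - j) * rewarded i j t c)%N.

Definition mass_den (t c : nat) : nat :=
  (level_cost (level c) * 2 ^ 2 ^ (level c).+1 * 2 ^ t)%N.

Definition mass (t c : nat) : rat := (mass_num t c)%:R / (mass_den t c)%:R.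

Lemma level_cost_gt0 k : (0 < level_cost k)%N.
Proof. by rewrite !muln_gt0 expn_gt0. Qed.

Lemma mass_den_gt0 t c : (0 < mass_den t c)%N.
Proof. by rewrite /mass_den 2!muln_gt0 level_cost_gt0 !expn_gt0. Qed.

Lemma level_le c : (level c <= c)%N.
Proof. exact: leq_trans (trunc_log_le _ _) (trunc_log_le _ _). Qed.

Lemma level_lt c : (c < 2 ^ 2 ^ (level c).+1)%N.
Proof.
apply: leq_trans (trunc_log_ltn (p := 2) c isT) _.
by rewrite leq_exp2l // trunc_log_ltn.
Qed.

Lemma massE t c :
  mass t c = (level_cost (level c))%:R^-1 *
    \sum_(i < 2 ^ (level c).+1) \sum_(j < t.+1)
      2 ^- i * 2 ^- j * (rewarded i j t c)%:R.
Proof.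
have n2 n : (2 : rat) ^+ n != 0 by rewrite expf_neq0.
set d : rat := (level_cost _)%:R.
have d0 : d != 0
  by rewrite pnatr_eq0 -lt0n level_cost_gt0.
rewrite /mass /mass_num /mass_den 2!natrM !natrX natr_sum -/d.
move: d d0 => d d0; rewrite mulr_suml mulr_sumr.
apply: eq_bigr => i _; rewrite natr_sum mulr_suml mulr_sumr.
apply: eq_bigr => j _; rewrite !natrM !natrX.
have -> : (2 : rat) ^+ (2 ^ (level c).+1) =
    2 ^+ (2 ^ (level c).+1 - i) * 2 ^+ i by rewrite -exprD subnK // ltnW.
have -> : (2 : rat) ^+ t = 2 ^+ (t - j) * 2 ^+ j
  by rewrite -exprD subnK // -ltnS.
by field; rewrite !n2 d0.
Qed.

Lemma mass_ge0 t c : 0 <= mass t c.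
Proof. by rewrite divr_ge0. Qed.

Lemma rewardedS i j t c : rewarded i j t c -> rewarded i j t.+1 c.
Proof.
by move=> /existsP[s Hs]; apply/existsP; exists (widen_ord (leqnSn _) s).
Qed.

Lemma mass_nondecreasing c : {homo mass ^~ c : t u / (t <= u)%N >-> t <= u}.
Proof.
apply: homo_leq => // [y x z|t]; first exact: le_trans.
rewrite !massE ler_wpM2l ?invr_ge0 ?ler0n //.
(* Stage [t.+1] keeps every earlier reward and adds the terms for [j = t.+1]. *)
apply: ler_sum => i _; rewrite [leRHS]big_ord_recr /=.
rewrite -[leLHS]addr0 lerD //.
  apply: ler_sum => j _; rewrite ler_wpM2l ?mulr_ge0 ?invr_ge0 ?exprn_ge0 //.
  rewrite ler_nat; have := @rewardedS i j t c.
  by case: rewarded => // ->.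
Qed.

Hypothesis S_decr : forall j s t c, (s <= t)%N -> S j t c -> S j s c.

(* The rewarded codes are all alive at the first stage where fewer than
   2 ^ i.+1 codes are left, whichever stage made them rewarded. *)
Lemma rewarded_count (n k i j t : nat) :
  (\sum_(c < n | level c == k) rewarded i j t c <= 2 ^ i.+1)%N.
Proof.
pose good s := (alive_count j s k < 2 ^ i.+1)%N.
have [ex_s|no_s] := pselect (exists s, good s); last first.
  rewrite big1 // => c /eqP lc; apply/eqP; rewrite eqb0.
  by apply/existsP => -[s /andP[_ gs]]; apply: no_s;
    exists s; rewrite /good -lc.
case: (ex_minnP ex_s) => s0 gs0 min_s0.
apply: leq_trans (ltnW gs0).
have rS c : level c = k -> rewarded i j t c -> S j s0 c.
  move=> lc /existsP[s /andP[Ss gs]]; apply: S_decr Ss; apply: min_s0.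
  by rewrite /good -lc.
pose g c := ((level c == k) && S j s0 c : nat).
set N := (2 ^ 2 ^ k.+1)%N.
(* Summing up to [N + n] avoids comparing [n] with [N]; codes from [N] on have a level other than
   [k] and contribute nothing. *)
apply: leq_trans (_ : \sum_(0 <= c < N + n) g c <= _)%N.
  rewrite (big_cat_nat (n := n)) ?leq_addl //=; apply: leq_trans (leq_addr _ _).
  rewrite big_mkcond /= big_mkord; apply: leq_sum => c _; rewrite /g.
  case: eqP => // lc; case rc : rewarded => //.
  by rewrite (rS _ lc rc).
rewrite (big_cat_nat (n := N)) ?leq_addr //= big_mkord.
have -> : (\sum_(N <= c < N + n) g c = 0)%N; last by rewrite addn0.
rewrite big_nat_cond big1 // => c.
rewrite andbT => /andP[le_Nc _]; rewrite /g; case: eqP => // lc.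
by have := level_lt c; rewrite lc ltnNge le_Nc.
Qed.

Lemma sum_geom_le (n : nat) : \sum_(j < n) (2 : rat) ^- j <= 2.
Proof.
suff -> : \sum_(j < n) (2 : rat) ^- j = 2 - 2 * 2 ^- n.
  by rewrite gerBl mulr_ge0 ?invr_ge0 ?exprn_ge0.
elim: n => [|n IHn]; first by rewrite big_ord0 expr0; field.
by rewrite big_ord_recr /= IHn exprS; field; rewrite expf_neq0.
Qed.

(** For fixed i and j at most 2^(i+1) codes receive 2^-(i+j), up to the cost factor, hence 2 * 2^-j
    together. Summing over j gives at most 4, and over the 2^(k+1) values of i at most 8 * 2^k,
    which cancels against [level_cost k]. *)
Lemma level_mass_le (n t k : nat) :
  \sum_(c < n | level c == k) mass t c <= (k.+1%:R * k.+2%:R)^-1.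
Proof.
have -> : \sum_(c < n | level c == k) mass t c = (level_cost k)%:R^-1 *
    \sum_(i < 2 ^ k.+1) \sum_(j < t.+1) 2 ^- i * 2 ^- j *
      (\sum_(c < n | level c == k) rewarded i j t c)%:R.
  transitivity (\sum_(c < n | level c == k) (level_cost k)%:R^-1 *
    \sum_(i < 2 ^ k.+1) \sum_(j < t.+1) 2 ^- i * 2 ^- j *
      ((rewarded i j t c)%:R : rat)).
    by apply: eq_bigr => c /eqP lc; rewrite massE lc.
  rewrite -mulr_sumr exchange_big; congr (_ * _); apply: eq_bigr => i _.
  rewrite exchange_big; apply: eq_bigr => j _.
  by rewrite -mulr_sumr natr_sum.
apply: le_trans (_ : (level_cost k)%:R^-1 * \sum_(i < 2 ^ k.+1) 4 <= _).
  rewrite ler_wpM2l ?invr_ge0 ?ler0n //; apply: ler_sum => i _.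
  apply: le_trans (_ : \sum_(j < t.+1) 2 * 2 ^- j <= _); last first.
    by rewrite -mulr_sumr (natrM _ 2 2) ler_wpM2l // sum_geom_le.
  apply: ler_sum => j _.
  rewrite mulrAC ler_wpM2r ?invr_ge0 ?exprn_ge0 //.
  rewrite mulrC ler_pdivrMr ?exprn_gt0 // -exprS -natrX ler_nat.
  exact: rewarded_count.
have p2 : (2 : rat) ^+ k != 0 by rewrite expf_neq0.
have -> : (level_cost k)%:R = 8 * 2 ^+ k * (k.+1%:R * k.+2%:R) :> rat.
  by rewrite /level_cost 3!natrM natrX.
rewrite sumr_const card_ord -(mulr_natr 4) natrX exprS.
rewrite le_eqVlt; apply/orP; left; apply/eqP.
have k1 : k.+1%:R != 0 :> rat by rewrite pnatr_eq0.
have k2 : k.+2%:R != 0 :> rat by rewrite pnatr_eq0.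
move: k.+1%:R k.+2%:R k1 k2 => u w u0 w0.
by field; rewrite u0 w0 p2.
Qed.

Lemma sum_telescope_le1 (n : nat) :
  \sum_(k < n) (k.+1%:R * k.+2%:R : rat)^-1 <= 1.
Proof.
suff -> : \sum_(k < n) (k.+1%:R * k.+2%:R : rat)^-1 = 1 - n.+1%:R^-1.
  by rewrite gerBl invr_ge0.
elim: n => [|n IHn]; first by rewrite big_ord0 invr1 subrr.
rewrite big_ord_recr /= IHn.
have n1 : n.+1%:R != 0 :> rat by rewrite pnatr_eq0.
have n2 : n.+2%:R != 0 :> rat by rewrite pnatr_eq0.
rewrite -[n.+2%:R]natr1 in n2 *.
by move: n.+1%:R n1 n2 => u u0 u1; field; rewrite u0 u1.
Qed.

Lemma mass_total_le1 (n t : nat) : \sum_(c < n) mass t c <= 1.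
Proof.
apply: le_trans (sum_telescope_le1 n).
(* Codes below [n] only meet levels below [n], so the telescoping sum with [n] terms suffices. *)
have lev_lt (c : 'I_n) : (level c < n)%N.
  exact: leq_ltn_trans (level_le c) (ltn_ord c).
rewrite (partition_big (fun c : 'I_n => Ordinal (lev_lt c)) predT) //=.
by apply: ler_sum => k _; apply: level_mass_le.
Qed.
End Mass.

(** * Levels and inverses of string codes *)

Lemma string_code_rcons x b :
  string_code (rcons x b) = ((string_code x).*2 + b)%N.
Proof. by rewrite /string_code foldl_rcons. Qed.

Lemma string_code_bounds x :
  (2 ^ size x <= string_code x < 2 ^ (size x).+1)%N.
Proof.
elim/last_ind: x => [//|x b /andP[lo hi]].
rewrite string_code_rcons size_rcons !(expnS 2 (size x)) !expnS.
rewrite expnS in hi; apply/andP; split; case: b; lia.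
Qed.

Lemma string_code_gt0 x : (0 < string_code x)%N.
Proof.
have /andP[lo _] := string_code_bounds x.
by apply: leq_trans lo; rewrite expn_gt0.
Qed.

(** The code has [size x + 1] binary digits, so the inner logarithm in [level] recovers the
    length. *)
Lemma level_string_code x : level (string_code x) = trunc_log 2 (size x).
Proof. by rewrite /level (trunc_log_eq _ (string_code_bounds x)). Qed.

(** Halving a code removes the last letter of its string. *)
Lemma string_code_surj c : (0 < c)%N -> exists x, string_code x = c.
Proof.
elim/ltn_ind: c => c IHc c_gt0.
have [c_gt1|c_le1] := ltnP 1 c; last first.
  by exists [::]; apply: anti_leq; rewrite c_le1 c_gt0.
have [x xE] : exists x, string_code x = c./2 by apply: IHc; lia.
exists (rcons x (odd c)); rewrite string_code_rcons xE addnC.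
exact: odd_double_half.
Qed.

(** * Computability of the mass *)

Lemma recursive_level {k} (f : k.-tuple nat -> nat) :
  recursive f -> recursive (fun v => level (f v)).
Proof. by move=> rf; do 2!apply: recursive_trunc_log. Qed.

Lemma recursive_level_cost {k} (f : k.-tuple nat -> nat) :
  recursive f -> recursive (fun v => level_cost (f v)).
Proof.
move=> rf; rewrite /level_cost.
have rn n : recursive (fun _ : k.-tuple nat => n) := recursive_const n.
apply: recursive_mul; last by apply: recursive_mul; do !apply: recursive_succ.
by apply: recursive_mul => //; apply: recursive_exp.
Qed.

(** Stated with arbitrary recursive arguments so that it applies directly under bounded sums and
    quantifiers. *)
Definition recursive_rel3 (S : nat -> nat -> nat -> bool) :=
  forall (k : nat) (f g h : k.-tuple nat -> nat),
    recursive f -> recursive g -> recursive h ->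
    recursive (fun v => S (f v) (g v) (h v) : nat).

Lemma recursive_alive_count {S k} (f g h : k.-tuple nat -> nat) :
  recursive_rel3 S -> recursive f -> recursive g -> recursive h ->
  recursive (fun v => alive_count S (f v) (g v) (h v)).
Proof.
move=> rS rf rg rh; rewrite /alive_count.
have r2 : recursive (fun _ : k.-tuple nat => 2) := recursive_const 2.
apply: (recursive_sum (fun c v => (level c == h v) && S (f v) (g v) c : nat)).
  by do 2!apply: recursive_exp => //; apply: recursive_succ.
have {}rf := recursive_behead _ rf; have {}rg := recursive_behead _ rg.
have {}rh := recursive_behead _ rh; have rc := recursive_thead k.
apply: recursive_and; last exact: rS.
by apply: recursive_eq => //; exact: recursive_level.
Qed.

Lemma recursive_rewarded {S k} (i j t c : k.-tuple nat -> nat) :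
  recursive_rel3 S ->
  recursive i -> recursive j -> recursive t -> recursive c ->
  recursive (fun v => rewarded S (i v) (j v) (t v) (c v) : nat).
Proof.
move=> rS ri rj rt rc; rewrite /rewarded.
apply: (recursive_exists (fun s v => S (j v) s (c v) &&
  (alive_count S (j v) s (level (c v)) < 2 ^ (i v).+1)%N)).
  exact: recursive_succ.
have {}ri := recursive_behead _ ri; have {}rj := recursive_behead _ rj.
have {}rc := recursive_behead _ rc.
have rs := recursive_thead k.
apply: recursive_and; first exact: rS.
apply: recursive_leq; last first.
  by apply: recursive_exp; [exact: recursive_const|exact: recursive_succ].
by apply: recursive_succ; apply: recursive_alive_count => //;
  apply: recursive_level.
Qed.

Lemma recursive_mass_num {S k} (t c : k.-tuple nat -> nat) :
  recursive_rel3 S -> recursive t -> recursive c ->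
  recursive (fun v => mass_num S (t v) (c v)).
Proof.
move=> rS rt rc; rewrite /mass_num.
have r2 n : recursive (fun _ : n.-tuple nat => 2) := recursive_const 2.
have rM n (f : n.-tuple nat -> nat) :
    recursive f -> recursive (fun v => (2 ^ (level (f v)).+1)%N).
  move=> rf; apply: recursive_exp => //; apply: recursive_succ.
  exact: recursive_level.
apply: (recursive_sum (fun i v => \sum_(j < (t v).+1)
  2 ^ (2 ^ (level (c v)).+1 - i) * 2 ^ (t v - j) *
  rewarded S i j (t v) (c v))%N); first exact: rM.
have {}rt := recursive_behead _ rt; have {}rc := recursive_behead _ rc.
have ri := recursive_thead k.
apply: (recursive_sum (fun j (v : k.+1.-tuple nat) =>
  2 ^ (2 ^ (level (c (behead_tuple v))).+1 - thead v) *
  2 ^ (t (behead_tuple v) - j) *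
  rewarded S (thead v) j (t (behead_tuple v)) (c (behead_tuple v)))%N).
  exact: recursive_succ.
have {}rt := recursive_behead _ rt; have {}rc := recursive_behead _ rc.
have {}ri := recursive_behead _ ri; have rj := recursive_thead k.+1.
apply: recursive_mul; last exact: recursive_rewarded.
by apply: recursive_mul; apply: recursive_exp => //; apply: recursive_sub => //;
  apply: rM.
Qed.

Lemma recursive_mass_den {k} (t c : k.-tuple nat -> nat) :
  recursive t -> recursive c -> recursive (fun v => mass_den (t v) (c v)).
Proof.
move=> rt rc; rewrite /mass_den.
have r2 : recursive (fun _ : k.-tuple nat => 2) := recursive_const 2.
have rl := recursive_level _ rc.
apply: recursive_mul; last exact: recursive_exp.
apply: recursive_mul; first exact: recursive_level_cost.
by do 2!apply: recursive_exp => //; apply: recursive_succ.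
Qed.

Lemma mass_computable S : recursive_rel3 S ->
  computable_rat_approx (fun t x => mass S t (string_code x)).
Proof.
move=> rS.
have r0 := recursive_thead 1; have r1 := recursive_behead _ (recursive_thead 0).
exists (fun=> 0%N), (fun v => mass_num S (thead v) (thead (behead_tuple v))),
  (fun v => mass_den (thead v) (thead (behead_tuple v))).
split; first exact: rec_zero.
- exact: recursive_mass_num.
- exact: recursive_mass_den.
move=> t x /=.
by split; [exact: mass_den_gt0|rewrite expr0 mul1r].
Qed.

(** * Sums over strings and the limit semimeasure *)

Lemma sum_mass_strings_le1 (S : nat -> nat -> nat -> bool) t
    (r : seq (seq bool)) :
  (forall j s t c, (s <= t)%N -> S j t c -> S j s c) -> uniq r ->
  \sum_(x <- r) mass S t (string_code x) <= 1.
Proof.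
move=> S_decr r_uniq.
pose n := (\max_(x <- r) string_code x).+1.
apply: le_trans (mass_total_le1 _ S_decr n t).
rewrite -(big_map string_code predT (mass S t)) /=.
rewrite -(big_mkord predT (mass S t)).
rewrite [leRHS](bigID (mem [seq string_code x | x <- r])) /=.
apply: ler_wpDr; first by apply: sumr_ge0 => c _; exact: mass_ge0.
rewrite -[leRHS]big_filter le_eqVlt; apply/orP; left; apply/eqP/perm_big.
apply: uniq_perm; rewrite ?filter_uniq ?iota_uniq //.
  by rewrite map_inj_uniq //; exact: string_code_inj.
move=> c; rewrite mem_filter mem_index_iota; apply/idP/idP => [cr|/andP[]//].
rewrite cr /=; case/mapP: cr => x xr ->.
by rewrite ltnS; apply: leq_bigmax_seq.
Qed.

(** Reduces both the semimeasure and the sumtest condition to finite sums. *)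
Lemma esum_le1P (R : realType) (T : choiceType) (f : T -> R) :
  (forall x, 0 <= f x) ->
  (\esum_(x in [set: T]) (f x)%:E <= 1)%E <->
  forall r : seq T, uniq r -> \sum_(x <- r) f x <= 1.
Proof.
move=> f0; split=> [le1 r ur|H].
  rewrite -lee_fin; apply: le_trans le1; apply: esum_ge.
  exists [set` r]%classic; first by split => //; exact: finite_seq.
  by rewrite -fsbig_seq // sumEFin.
apply: ge_ereal_sup => _ [A [finA _] <-].
rewrite fsbig_finite // sumEFin lee_fin; apply: H.
exact: finmap.fset_uniq.
Qed.

Section LimitMass.
Local Open Scope classical_set_scope.
Context {R : realType} (S : nat -> nat -> nat -> bool).
Hypothesis S_decr : forall j s t c, (s <= t)%N -> S j t c -> S j s c.

Definition limit_mass (x : seq bool) : R :=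
  limn (fun t => ratr (mass S t (string_code x)) : R).

Let mass_homo x :
  {homo (fun t => ratr (mass S t (string_code x)) : R) :
    t u / (t <= u)%N >-> t <= u}.
Proof. by move=> t u tu; rewrite ler_rat mass_nondecreasing. Qed.

Lemma mass_cvg x :
  (fun t => ratr (mass S t (string_code x)) : R) @ \oo --> limit_mass x.
Proof.
apply: nondecreasing_is_cvgn (mass_homo x) _.
(* The bound 1 is the total mass bound applied to the one-element list of [x]. *)
exists 1 => _ [t _ <-]; rewrite -[leRHS](rmorph1 ratr) ler_rat.
have := @sum_mass_strings_le1 S t [:: x] S_decr isT.
by rewrite big_seq1.
Qed.

Lemma mass_le_limit t x : ratr (mass S t (string_code x)) <= limit_mass x.
Proof.
apply: (nondecreasing_cvgn_le (mass_homo x)).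
by apply/cvg_ex; exists (limit_mass x); exact: mass_cvg.
Qed.

Lemma limit_mass_ge0 x : 0 <= limit_mass x.
Proof. by apply: le_trans (mass_le_limit 0 x); rewrite ler0q mass_ge0. Qed.

Lemma limit_mass_semimeasure : discrete_semimeasure limit_mass.
Proof.
split; first exact: limit_mass_ge0.
apply/(esum_le1P _ _ _ limit_mass_ge0) => r ur.
have sum_cvg :
    (fun t => \sum_(x <- r) ratr (mass S t (string_code x)) : R) @ \oo -->
    \sum_(x <- r) limit_mass x.
  apply: cvg_big => [|x _]; first exact: add_continuous.
  exact: mass_cvg.
rewrite -(cvg_lim _ sum_cvg) //; apply: limr_le.
  by apply/cvg_ex; eexists; exact: sum_cvg.
near=> t; rewrite -rmorph_sum -[leRHS](rmorph1 ratr) ler_rat.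
exact: sum_mass_strings_le1.
Unshelve. all: end_near. Qed.

Lemma limit_mass_lower : recursive_rel3 S -> lower_semicomputable limit_mass.
Proof.
move=> rS; exists (fun t x => mass S t (string_code x)); split.
- exact: mass_computable.
- by move=> x t u tu; exact: mass_nondecreasing.
- exact: mass_cvg.
Qed.

(** With n codes alive, the index i with 2^i <= n < 2^(i+1) triggers a reward, and its factor 2^-i
    is at least 1/n. The upper bound on the count keeps i below 2^(k+1), within the range of the
    sum. *)
Lemma limit_mass_ge (T j : nat) (x : seq bool) :
  let k := level (string_code x) in
  (0 < alive_count S j T k)%N ->
  S j T (string_code x) ->
  (alive_count S j T k < 2 ^ 2 ^ k.+1)%N ->
  ((2 ^ j * level_cost k * alive_count S j T k)%:R)^-1 <= limit_mass x.
Proof.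
move=> k n_gt0 Sx nN; set n := alive_count S j T k in n_gt0 nN *.
set i := trunc_log 2 n.
(* The stage must reach [T], to see the count, and [j], to include this threshold number. *)
apply: le_trans (mass_le_limit (maxn T j) x).
have n_ge : (2 ^ i <= n)%N by apply: trunc_logP.
have lt_i : (i < 2 ^ k.+1)%N.
  by rewrite -(ltn_exp2l _ _ (m := 2)) //; apply: leq_ltn_trans nN.
have lt_j : (j < (maxn T j).+1)%N by rewrite ltnS leq_maxr.
have lt_T : (T < (maxn T j).+1)%N by rewrite ltnS leq_maxl.
have rew : rewarded S i j (maxn T j) (string_code x).
  apply/existsP; exists (Ordinal lt_T); rewrite Sx /=.
  exact: trunc_log_ltn.
apply: le_trans (_ : ratr ((level_cost k)%:R^-1 * (2 ^- i * 2 ^- j)) <= _).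
  rewrite !(rmorphM, fmorphV, rmorphXn) /= !ratr_nat.
  rewrite -!invfM -!natrX -!natrM lef_pV2 ?posrE ?ltr0n ?muln_gt0 ?expn_gt0
    ?level_cost_gt0 ?n_gt0 //.
  rewrite ler_nat; nia.
rewrite ler_rat massE -/k ler_wpM2l ?invr_ge0 ?ler0n //.
rewrite (bigD1 (Ordinal lt_i)) //= (bigD1 (Ordinal lt_j)) //= rew mulr1.
rewrite -addrA lerDl addr_ge0 //; apply: sumr_ge0 => *;
  rewrite ?sumr_ge0 // => *; by rewrite !mulr_ge0 ?invr_ge0 ?exprn_ge0.
Qed.
End LimitMass.

(** * Superlevel sets of the sumtest and the bound on each level *)

(* The sign of the approximation is ignored: it can only be negative when the
   numerator is 0, since the approximations decrease to e >= 0. *)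
Definition superlevel (a b : 2.-tuple nat -> nat) (j s c : nat) : bool :=
  (0 < c)%N &&
  (4 ^ j * level_cost (level c) * b [tuple s; c] <= a [tuple s; c])%N.

Lemma recursive_superlevel a b :
  recursive a -> recursive b -> recursive_rel3 (superlevel a b).
Proof.
move=> ra rb k j s c rj rs rc; rewrite /superlevel.
have rn n : recursive (fun _ : k.-tuple nat => n) := recursive_const n.
apply: recursive_and; first exact: recursive_leq.
apply: recursive_leq; last exact: recursive_comp2.
apply: recursive_mul; last exact: recursive_comp2.
apply: recursive_mul; first exact: recursive_exp.
by apply: recursive_level_cost; apply: recursive_level.
Qed.

Section SumtestBound.
Local Open Scope classical_set_scope.

Lemma superlevel_string (R : realType) (e : seq bool -> R) q sg a b :
  (forall x, 0 <= e x) ->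
  (forall t x, let v := [tuple t; string_code x] in
     (0 < b v)%N /\ q t x = (-1) ^+ sg v * (a v)%:R / (b v)%:R) ->
  (forall x, nonincreasing_seq (q ^~ x)) ->
  (forall x, (fun t => ratr (q t x) : R) @ \oo --> e x) ->
  forall j s x, superlevel a b j s (string_code x) =
    ((4 ^ j * level_cost (level (string_code x)))%:R <= q s x).
Proof.
move=> e0 qE q_decr q_cvg j s x.
have q_ge0 : 0 <= q s x.
  rewrite -(ler0q R); apply: le_trans (e0 x) _.
  rewrite -(cvg_lim _ (q_cvg x)) //.
  apply: (nonincreasing_cvgn_ge (u_ := fun t => ratr (q t x) : R)).
    by move=> t u tu; rewrite ler_rat; exact: q_decr.
  by apply/cvg_ex; exists (e x); exact: q_cvg.
have [b_gt0 qsx] := qE s x.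
have {}qsx :
    q s x = (a [tuple s; string_code x])%:R / (b [tuple s; string_code x])%:R.
  move: q_ge0; rewrite qsx -mulrA; set u := _ / _.
  have u0 : 0 <= u by rewrite divr_ge0.
  (* An odd sign makes the value both nonnegative and at most 0, so the fraction vanishes. *)
  rewrite -signr_odd; case: odd; rewrite ?expr0 ?mul1r // expr1 mulN1r.
  rewrite oppr_ge0 => u_le0.
  by have -> : u = 0; [apply/le_anti; rewrite u0 u_le0|rewrite oppr0].
rewrite qsx /superlevel string_code_gt0 /= ler_pdivlMr ?ltr0n //.
by rewrite -[X in _ * X]/((_)%:R) -natrM ler_nat.
Qed.

(** The code 0 is counted in the range but never alive, which makes the inequality strict, as
    [limit_mass_ge] requires. *)
Lemma alive_count_lt S j s k : ~~ S j s 0%N ->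
  (alive_count S j s k < 2 ^ 2 ^ k.+1)%N.
Proof.
move=> /negbTE S0; rewrite /alive_count.
have : (0 < 2 ^ 2 ^ k.+1)%N by rewrite expn_gt0.
case: (2 ^ 2 ^ k.+1)%N => // n _.
rewrite big_ord_recl /= S0 andbF ltnS add0n.
apply: leq_trans (_ : \sum_(i < n) 1 <= _)%N; last first.
  by rewrite sum1_card card_ord.
by apply: leq_sum => i _; exact: leq_b1.
Qed.

Lemma alive_strings S j s k : (forall j s, ~~ S j s 0%N) ->
  exists r : seq (seq bool),
    [/\ uniq r, size r = alive_count S j s k &
        forall x, (x \in r) =
          (level (string_code x) == k) && S j s (string_code x)].
Proof.
move=> S0.
(* [dec] decodes positive numbers; its value at 0 is arbitrary. *)
have /boolp.choice[dec decK] c : exists x, (0 < c)%N -> string_code x = c.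
  by case: (posnP c) => [->|/string_code_surj[x xE]]; [exists [::]|exists x].
pose A := [seq c <- index_iota 0 (2 ^ 2 ^ k.+1) | (level c == k) && S j s c].
have A_gt0 c : c \in A -> (0 < c)%N.
  by rewrite mem_filter lt0n => /andP[/andP[_ Sc] _];
    apply: contraTneq Sc => ->.
exists [seq dec c | c <- A]; split.
- rewrite map_inj_in_uniq ?filter_uniq ?iota_uniq // => c d cA dA E.
  by rewrite -(decK c (A_gt0 c cA)) E decK // A_gt0.
- rewrite size_map size_filter -sum1_count /alive_count.
  rewrite big_mkord [LHS]big_mkcond.
  by apply: eq_bigr => c _; case: (_ && _).
move=> x; apply/mapP/idP => [[c cA ->]|Sx].
  by rewrite decK ?A_gt0 //; move: cA; rewrite mem_filter => /andP[].
exists (string_code x); last first.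
  by apply: string_code_inj; rewrite decK // string_code_gt0.
rewrite mem_filter Sx mem_index_iota /=.
by case/andP: Sx => /eqP <- _; exact: level_lt.
Qed.

Lemma sumtest_level_bound (R : realType) (m e : seq bool -> R) :
  universal_semimeasure m -> sumtest m e -> upper_semicomputable e ->
  exists j : nat,
    forall x, e x < (4 ^ j * level_cost (level (string_code x)))%:R.
Proof.
move=> [[m0 _] _ m_univ] [e0 me_le1].
move=> [q [[sg [a [b [_ ra rb qE]]]] q_decr q_cvg]].
pose S := superlevel a b.
have SE := superlevel_string R e q sg a b e0 qE q_decr q_cvg.
have S0 j s : ~~ S j s 0%N by [].
have S_decr j s t c : (s <= t)%N -> S j t c -> S j s c.
  move=> st; have [->|/string_code_surj[x <-]] := posnP c; first by [].
  by rewrite /S !SE => /le_trans; apply; exact: q_decr.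
pose P := limit_mass (R := R) S.
have [c c_gt0 Pc] := m_univ P (limit_mass_semimeasure S S_decr)
  (limit_mass_lower S S_decr (recursive_superlevel a b ra rb)).
have sum_Pe r : uniq r -> \sum_(x <- r) P x * e x <= c.
  move=> ur; apply: le_trans (_ : \sum_(x <- r) c * (m x * e x) <= _).
    by apply: ler_sum => x _; rewrite mulrA ler_wpM2r.
  rewrite -mulr_sumr -[leRHS]mulr1 ler_wpM2l ?(ltW c_gt0) //.
  apply: (iffLR (esum_le1P _ _ (fun x => m x * e x) _)) => // x.
  by rewrite mulr_ge0.
(* For this [j], c < j < 2^j; a string at or above the threshold will give 2^j <= c. *)
exists (Num.bound c) => x; rewrite ltNge; apply/negP => ex.
set j := Num.bound c in ex; set k := level _ in ex.
have : (2 ^ j)%:R <= c; last first.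
  apply/negP; rewrite -ltNge; apply: lt_le_trans (archi_boundP (ltW c_gt0)) _.
  by rewrite ler_nat ltnW // ltn_expl.
(* A level is finite, so by some stage [T] every string whose limit lies below the threshold has
   dropped out. [T] is only shown to exist; it need not be computable. *)
have [T HT] : exists T, forall y, level (string_code y) = k ->
    S j T (string_code y) -> (4 ^ j * level_cost k)%:R <= e y.
  have /boolp.choice[T HT] n : exists T, forall y, string_code y = n ->
      level n = k -> S j T n -> (4 ^ j * level_cost k)%:R <= e y.
    have [/string_code_surj[y yE]|n0] := boolP (0 < n)%N; last first.
      by exists 0%N => y yE; move: n0; rewrite -yE string_code_gt0.
    have [ey|ey] := lerP (4 ^ j * level_cost k)%:R (e y).
      by exists 0%N => z; rewrite -yE => /string_code_inj -> .
    have : \forall t \near \oo, ratr (q t y) < (4 ^ j * level_cost k)%:R :> R.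
      exact: (cvgr_lt _ (q_cvg y)).
    move=> [T _ HT]; exists T => z; rewrite -yE => _ lk.
    rewrite /S SE lk -(ler_rat R) ratr_nat => qT.
    by have := HT T (leqnn T); rewrite /= ltNge qT.
  exists (\max_(n < 2 ^ 2 ^ k.+1) T n)%N => y yk Sy.
  have yn : (string_code y < 2 ^ 2 ^ k.+1)%N by rewrite -yk level_lt.
  apply: HT (erefl _) yk _; apply: S_decr Sy.
  exact: (leq_bigmax (Ordinal yn)).
have [r [ur sr rE]] := alive_strings S j T k S0.
(* The approximations decrease to [e x], so [x] never drops out and the count stays positive. *)
have xr : x \in r.
  rewrite rE eqxx /S SE -(ler_rat R) ratr_nat; apply: le_trans ex _.
  rewrite -(cvg_lim _ (q_cvg x)) //.
  apply: (nonincreasing_cvgn_ge (u_ := fun t => ratr (q t x) : R)).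
    by move=> t u tu; rewrite ler_rat; exact: q_decr.
  by apply/cvg_ex; exists (e x); exact: q_cvg.
have n_gt0 : (0 < alive_count S j T k)%N.
  by rewrite -sr; case: (r) xr.
apply: le_trans (sum_Pe r ur).
set n := alive_count S j T k in sr n_gt0.
set C := level_cost k.
(* Each of the n strings contributes at least 4^j * C / (2^j * C * n) = 2^j / n. The threshold grows
   like 4^j and the reward shrinks only like 2^-j, which leaves the factor 2^j. *)
have -> : (2 ^ j)%:R =
    \sum_(y <- r) (2 ^ j * C * n)%:R^-1 * (4 ^ j * C)%:R :> R.
  rewrite big_const_seq count_predT iter_addr_0 sr -mulr_natr.
  have : C%:R != 0 :> R by rewrite pnatr_eq0 -lt0n level_cost_gt0.
  have : n%:R != 0 :> R by rewrite pnatr_eq0 -lt0n.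
  have : (2 ^ j)%:R != 0 :> R by rewrite pnatr_eq0 expn_eq0.
  rewrite (expnMn 2 2); move: (2 ^ j)%N (C) (n) => u w z u0 z0 w0.
  by rewrite !natrM; field; rewrite u0 w0 z0.
rewrite big_seq [leRHS]big_seq.
apply: ler_sum => y; rewrite rE => /andP[/eqP yk Sy].
apply: ler_pM; rewrite ?invr_ge0 //; last exact: HT.
have := limit_mass_ge (R := R) S S_decr T j y; rewrite yk; apply => //.
exact: alive_count_lt.
Qed.

End SumtestBound.

(** * From levels to lengths *)

Theorem theorem2 (R : realType) (m e : seq bool -> R) :
  universal_semimeasure m ->
  sumtest m e -> upper_semicomputable e ->
  exists c : R, forall x : seq bool, (2 <= size x)%N ->
    e x <= c * (size x)%:R * (log2 ((size x)%:R : R)) ^+ 2.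
Proof.
move=> um em ue.
have [j Hj] := sumtest_level_bound R m e um em ue.
(* 48 is 8 * 6: the 8 comes from [level_cost], and (k+1)(k+2) <= 6 k^2 once k >= 1, which length at
   least 2 ensures; equality holds at k = 1. *)
exists ((4 ^ j * 48)%:R) => x x2; apply: le_trans (ltW (Hj x)) _.
rewrite level_string_code; set n := size x in x2 *; set k := trunc_log 2 n.
have k_ge1 : (1 <= k)%N by rewrite trunc_log_gt0.
have n_ge : (2 ^ k <= n)%N by apply: trunc_logP => //; apply: ltnW.
have ln2 : 0 < ln (2 : R) by rewrite ln_gt0 // ltr1n.
have k_le : k%:R <= log2 (n%:R : R).
  rewrite /log2 ler_pdivlMr // mulr_natl -lnXn // ler_ln ?posrE ?exprn_gt0 //.
    by rewrite -natrX ler_nat.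
  by rewrite ltr0n; apply: leq_trans x2.
apply: le_trans (_ : (4 ^ j * 48)%:R * n%:R * k%:R ^+ 2 <= _); last first.
  by rewrite ler_wpM2l ?mulr_ge0 // ler_pXn2r ?nnegrE // (le_trans _ k_le).
rewrite -natrX -!natrM ler_nat /level_cost -[leqRHS]mulnA -[leqRHS]mulnA.
rewrite leq_mul2l.
apply/orP; right.
have : (k.+1 * k.+2 <= 6 * k ^ 2)%N by nia.
nia.
Qed.
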